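(* For any finite simple graph $G$ the following are equivalent: (1) $G$ is $\omega\psi$-perfect; (2) $G$ is $\chi\psi$-perfect; (3) $G$ is $(C_4,P_4,P_3\cup K_2,3K_2)$-free; (4) $G$ has one of the following structures: (i) if $G$ is disconnected, then either $G$ is an empty (edgeless) graph, or $G$ has exactly two non-trivial components and both of them are complete graphs, or $G$ has exactly one non-trivial component and this component is $(C_4,P_4,P_3\cup K_2,3K_2)$-free; (ii) if $G$ is connected, then either $G$ is a complete graph, or $G=K_m\oplus G'$ is the join of a complete graph $K_m$ ($m\ge 1$) and a disconnected graph $G'$ which has one of the three structures listed in (i) (i.e. $G'$ is edgeless, or $G'$ has exactly two non-trivial components and both are complete, or $G'$ has exactly one non-trivial component and it is $(C_4,P_4,P_3\cup K_2,3K_2)$-free).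
   Context: All graphs are finite and simple. $\omega(G)$ is the clique number and $\chi(G)$ the chromatic number of $G$. A vertex coloring $\varsigma: V(G)\to\{1,\dots,k\}$ (not necessarily proper) is complete if for every pair of distinct colors $i\neq j$ there is an edge whose end vertices receive colors $i$ and $j$; the pseudoachromatic number $\psi(G)$ is the maximum $k$ for which a complete coloring of $G$ with $k$ colors exists. For graph parameters $a,b$, a graph $G$ is $ab$-perfect if $a(H)=b(H)$ for every induced subgraph $H$ of $G$. For graphs $H_1,\dots,H_m$, $G$ is $(H_1,\dots,H_m)$-free if no induced subgraph of $G$ is isomorphic to any $H_i$. $C_4$ is the 4-cycle, $P_n$ the path on $n$ vertices, $K_n$ the complete graph, $P_3\cup K_2$ the disjoint union of $P_3$ and $K_2$, $3K_2$ the disjoint union of three copies of $K_2$. A component is non-trivial if it has more than one vertex. The join $A\oplus B$ of two vertex-disjoint graphs is obtained from $A\cup B$ by adding all edges between $V(A)$ and $V(B)$. *)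

(* Defs.v *)
From mathcomp Require Import all_boot.

Set Implicit Arguments.
Unset Strict Implicit.
Unset Printing Implicit Defensive.

Record sgraph := SGraph {
  vertex :> finType;
  adj : rel vertex;
  adj_sym : symmetric adj;
  adj_irr : irreflexive adj }.

Definition isomorphic (G H : sgraph) : Prop :=
  exists2 f : G -> H, bijective f & forall x y, adj (f x) (f y) = adj x y.

Definition induced_adj (G : sgraph) (S : {set G}) : rel {x : G | x \in S} :=
  fun x y => adj (val x) (val y).

Lemma induced_sym (G : sgraph) (S : {set G}) : symmetric (@induced_adj G S).
Proof. by move=> x y; apply: adj_sym. Qed.

Lemma induced_irr (G : sgraph) (S : {set G}) : irreflexive (@induced_adj G S).
Proof. by move=> x; apply: adj_irr. Qed.

Definition induced (G : sgraph) (S : {set G}) := SGraph (@induced_sym G S) (@induced_irr G S).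

Definition complete_adj (n : nat) : rel 'I_n := fun i j => i != j.

Lemma complete_sym (n : nat) : symmetric (@complete_adj n).
Proof. by move=> i j; rewrite /complete_adj eq_sym. Qed.

Lemma complete_irr (n : nat) : irreflexive (@complete_adj n).
Proof. by move=> i; rewrite /complete_adj eqxx. Qed.

Definition complete_graph (n : nat) := SGraph (@complete_sym n) (@complete_irr n).

Definition path_adj (n : nat) : rel 'I_n := fun i j => (j == i.+1 :> nat) || (i == j.+1 :> nat).

Lemma path_sym (n : nat) : symmetric (@path_adj n).
Proof. by move=> i j; rewrite /path_adj orbC. Qed.

Lemma path_irr (n : nat) : irreflexive (@path_adj n).
Proof. by move=> i; rewrite /path_adj orbb ltn_eqF. Qed.

Definition path_graph (n : nat) := SGraph (@path_sym n) (@path_irr n).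

Definition cycle_adj (n : nat) : rel 'I_n := fun i j =>
  (i != j) && ((j == i.+1 %% n :> nat) || (i == j.+1 %% n :> nat)).

Lemma cycle_sym (n : nat) : symmetric (@cycle_adj n).
Proof. by move=> i j; rewrite /cycle_adj eq_sym orbC. Qed.

Lemma cycle_irr (n : nat) : irreflexive (@cycle_adj n).
Proof. by move=> i; rewrite /cycle_adj eqxx. Qed.

Definition cycle_graph (n : nat) := SGraph (@cycle_sym n) (@cycle_irr n).

(* [cross] is the adjacency between a vertex of A and a vertex of B. *)
Definition sum_adj (A B : sgraph) (cross : bool) : rel (A + B)%type := fun u v =>
  match u, v with
  | inl x, inl y => adj x y
  | inr x, inr y => adj x y
  | _, _ => cross
  end.

Lemma sum_sym (A B : sgraph) cross : symmetric (@sum_adj A B cross).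
Proof. by move=> [x|x] [y|y] //=; apply: adj_sym. Qed.

Lemma sum_irr (A B : sgraph) cross : irreflexive (@sum_adj A B cross).
Proof. by move=> [x|x] /=; apply: adj_irr. Qed.

Definition disjoint_union (A B : sgraph) := SGraph (@sum_sym A B false) (@sum_irr A B false).
Definition join (A B : sgraph) := SGraph (@sum_sym A B true) (@sum_irr A B true).

Definition clique (G : sgraph) (S : {set G}) : bool :=
  [forall x in S, forall y in S, (x != y) ==> adj x y].

Definition clique_number (G : sgraph) : nat := \max_(S : {set G} | clique S) #|S|.

Definition proper_coloring (G : sgraph) (k : nat) (c : {ffun G -> 'I_k}) : bool :=
  [forall x, forall y, adj x y ==> (c x != c y)].

Definition colorable (G : sgraph) (k : nat) : bool :=
  [exists c : {ffun G -> 'I_k}, proper_coloring c].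

Lemma colorable_ex (G : sgraph) : exists k, colorable G k.
Proof.
exists #|G|; apply/existsP; exists [ffun x => enum_rank x].
apply/forallP=> x; apply/forallP=> y; apply/implyP=> xy; rewrite !ffunE.
by apply: contraTneq xy => /enum_rank_inj->; rewrite adj_irr.
Qed.

Definition chromatic_number (G : sgraph) : nat := ex_minn (colorable_ex G).

Definition complete_coloring (G : sgraph) (k : nat) (c : {ffun G -> 'I_k}) : bool :=
  [forall i, forall j, (i != j) ==>
     [exists x, exists y, [&& adj x y, c x == i & c y == j]]].

Definition complete_colorable (G : sgraph) (k : nat) : bool :=
  [exists c : {ffun G -> 'I_k}, complete_coloring c].

(* The bound k <= #|G| excludes nothing when G has a vertex, by
   [complete_colorable_leq]. It matters only for the graph without vertices,
   whose empty map to 'I_1 is vacuously complete but does not use its color: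
   that graph has pseudoachromatic number 0. *)
Definition pseudoachromatic_number (G : sgraph) : nat :=
  \max_(k < #|G|.+1 | complete_colorable G k) k.

Lemma complete_colorable_leq (G : sgraph) k : 0 < #|G| -> complete_colorable G k -> k <= #|G|.
Proof.
move=> G0; case: k => [|[|k]] // /existsP[c /forallP cc].
have sub : [set: 'I_k.+2] \subset c @: [set: G].
  apply/subsetP=> i _; have [j ij] : exists j : 'I_k.+2, i != j.
    by case: (eqVneq i ord0) => [->|]; [exists ord_max | exists ord0].
  have /forallP/(_ j) := cc i; rewrite ij => /existsP[x /existsP[y /and3P[_ /eqP<- _]]].
  exact: imset_f.
by have := leq_trans (subset_leq_card sub) (leq_imset_card _ _); rewrite !cardsT card_ord.
Qed.

Definition perfect (a b : sgraph -> nat) (G : sgraph) : Prop :=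
  forall S : {set G}, a (induced S) = b (induced S).

Definition free (H G : sgraph) : Prop :=
  forall S : {set G}, ~ isomorphic (induced S) H.

Definition C4 : sgraph := cycle_graph 4.
Definition P4 : sgraph := path_graph 4.
Definition P3_K2 : sgraph := disjoint_union (path_graph 3) (complete_graph 2).
Definition three_K2 : sgraph :=
  disjoint_union (complete_graph 2)
    (disjoint_union (complete_graph 2) (complete_graph 2)).

Definition forbidden_free (G : sgraph) : Prop :=
  [/\ free C4 G, free P4 G, free P3_K2 G & free three_K2 G].

Definition edgeless (G : sgraph) : Prop := forall x y : G, ~~ adj x y.

Definition is_complete (G : sgraph) : Prop := forall x y : G, x != y -> adj x y.

(* The graph without vertices counts as connected (it is also complete). *)
Definition connected (G : sgraph) : Prop := forall x y : G, connect (@adj G) x y.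

Definition components (G : sgraph) : {set {set G}} :=
  equivalence_partition (connect (@adj G)) [set: G].

Definition nontrivial_components (G : sgraph) : {set {set G}} :=
  [set C in components G | 1 < #|C|].

Definition disconnected_structure (G : sgraph) : Prop :=
  [\/ edgeless G,
      #|nontrivial_components G| = 2 /\
        (forall C, C \in nontrivial_components G -> is_complete (induced C))
    | exists2 C, nontrivial_components G = [set C] & forbidden_free (induced C)].

Definition connected_structure (G : sgraph) : Prop :=
  is_complete G \/
  exists (m : nat) (G' : sgraph),
    [/\ 1 <= m, isomorphic G (join (complete_graph m) G'),
        ~ connected G' & disconnected_structure G'].

(* Main.v *)
Require Import Defs.
From mathcomp Require Import all_boot.

Set Implicit Arguments.
Unset Strict Implicit.
Unset Printing Implicit Defensive.

(** A minimum proper coloring is complete, so [omega <= chi <= psi], while each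
    forbidden graph is bipartite but has a complete 3-coloring; this gives
    (1) => (2) => (3).

    A connected nonempty (C4, P4)-free graph has a universal vertex: if a vertex
    [v] of maximum degree is not universal, some path [v - u - w] leaves its closed
    neighborhood, maximality yields a neighbor [z] of [v] not adjacent to [u], and
    [z, v, u, w] induce C4 or P4. Deleting the universal vertices gives (4).
    Conversely the forbidden graphs have neither universal nor isolated vertices,
    so a copy of one avoids [K_m] and the trivial components.

    For [psi <= omega], a clique with as many vertices as colors is found by
    induction. A universal vertex is deleted together with its color; isolated
    vertices play no role; and if the edges lie in two disjoint complete
    components, a color missing in one of them must meet every other color in the
    other one, so one of the two components sees all the colors. *)

(** * Embeddings *)

(** Containment as an induced subgraph up to isomorphism, stated by a map instead of a vertex set so
    that it composes. *)
Definition embeds (H G : sgraph) : Prop :=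
  exists2 f : H -> G, injective f & forall x y, adj (f x) (f y) = adj x y.

Lemma embeds_trans (A B C : sgraph) : embeds A B -> embeds B C -> embeds A C.
Proof.
move=> [f fI fE] [g gI gE]; exists (g \o f); first exact: inj_comp.
by move=> x y /=; rewrite gE fE.
Qed.

Lemma isomorphic_embeds (G H : sgraph) : isomorphic G H -> embeds G H.
Proof. by move=> [f /bij_inj fI fE]; exists f. Qed.

Lemma induced_embeds (G : sgraph) (S : {set G}) : embeds (induced S) G.
Proof. by exists val; [exact: val_inj | ]. Qed.

(** The image of an embedding is the vertex set of an induced copy; conversely, the inverse of an
    isomorphism from an induced subgraph is an embedding. *)
Lemma freeP (H G : sgraph) : free H G <-> ~ embeds H G.
Proof.
split=> [Hfree [f fI fE] | noH S [f [g fK gK] fE]]; last first.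
  apply: noH; apply: embeds_trans (induced_embeds S).
  by exists g; [exact: can_inj gK | move=> x y; rewrite -fE !gK].
pose S := f @: [set: H].
have fS x : f x \in S by apply: imset_f.
pose f' x : induced S := exist _ (f x) (fS x).
have surj (y : induced S) : exists x, f x == val y.
  by have /imsetP[x _ ->] := valP y; exists x.
pose g y := xchoose (surj y).
have gE y : f (g y) = val y by apply/eqP/(xchooseP (surj y)).
apply: (Hfree S); exists g; last by move=> x y; rewrite -fE !gE.
by exists f' => [y | x]; [apply: val_inj; rewrite /= gE | apply: fI; rewrite gE].
Qed.

Lemma free_embeds (H A B : sgraph) : embeds A B -> free H B -> free H A.
Proof. by move=> AB /freeP HB; apply/freeP => HA; apply: HB; apply: embeds_trans AB. Qed.

Lemma forbidden_free_embeds (A B : sgraph) :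
  embeds A B -> forbidden_free B -> forbidden_free A.
Proof. by move=> AB [? ? ? ?]; split; apply: free_embeds AB _. Qed.

(** Opposite vertices of a 4-cycle have the same neighbors, so their distinctness is assumed;
    consecutive ones differ by irreflexivity. *)
Lemma C4_embeds (G : sgraph) (a b c d : G) :
  adj a b -> adj b c -> adj c d -> adj d a -> ~~ adj a c -> ~~ adj b d ->
  a != c -> b != d -> embeds C4 G.
Proof.
move=> ab bc cd da /negbTE ac /negbTE bd /eqP anc /eqP bnd.
have E := (ab, bc, cd, da, ac, bd).
have E' := (adj_sym b a, adj_sym c b, adj_sym d c, adj_sym a d, adj_sym c a, adj_sym d b).
exists (fun i : 'I_4 => nth a [:: a; b; c; d] i); last first.
  by move=> [[|[|[|[|//]]]] ?] [[|[|[|[|//]]]] ?] /=; rewrite ?E ?E' ?E ?adj_irr.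
by move=> [[|[|[|[|//]]]] ?] [[|[|[|[|//]]]] ?] /= e; try exact: val_inj;
  exfalso; move: E anc bnd; rewrite e ?adj_irr // => -[[[[[]]]]] *; congruence.
Qed.

Lemma P4_embeds (G : sgraph) (a b c d : G) :
  adj a b -> adj b c -> adj c d -> ~~ adj d a -> ~~ adj a c -> ~~ adj b d ->
  embeds P4 G.
Proof.
move=> ab bc cd /negbTE da /negbTE ac /negbTE bd.
have E := (ab, bc, cd, da, ac, bd).
have E' := (adj_sym b a, adj_sym c b, adj_sym d c, adj_sym a d, adj_sym c a, adj_sym d b).
have fE (i j : 'I_4) : adj (nth a [:: a; b; c; d] i) (nth a [:: a; b; c; d] j) = path_adj i j.
  by move: i j => [[|[|[|[|//]]]] ?] [[|[|[|[|//]]]] ?] /=; rewrite ?E ?E' ?E ?adj_irr.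
exists (fun i : 'I_4 => nth a [:: a; b; c; d] i) => // i j eij.
(* distinct vertices of P4 have distinct neighborhoods *)
have {fE}tw k : path_adj i k = path_adj j k by rewrite -!fE eij.
have := (tw (@Ordinal 4 0 isT), tw (@Ordinal 4 1 isT), tw (@Ordinal 4 2 isT), tw (@Ordinal 4 3 isT)).
by move: i j {tw eij} => [[|[|[|[|//]]]] ?] [[|[|[|[|//]]]] ?] [[[]]] //= *; apply: val_inj.
Qed.

Lemma P3_embeds (G : sgraph) (a b c : G) :
  adj a b -> adj b c -> ~~ adj a c -> a != c -> embeds (path_graph 3) G.
Proof.
move=> ab bc /negbTE ac anc.
have E := (ab, bc, ac).
have E' := (adj_sym b a, adj_sym c b, adj_sym c a).
exists (fun i : 'I_3 => nth a [:: a; b; c] i); last first.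
  by move=> [[|[|[|//]]] ?] [[|[|[|//]]] ?] /=; rewrite ?E ?E' ?E ?adj_irr.
move=> [[|[|[|//]]] ?] [[|[|[|//]]] ?] /= e;
  try (by move: ab bc; rewrite ?e ?adj_irr // -e ?adj_irr);
  try (by move: anc; rewrite e eqxx); exact: val_inj.
Qed.

Lemma K2_embeds (G : sgraph) (a b : G) : adj a b -> embeds (complete_graph 2) G.
Proof.
move=> ab; have ba : adj b a by rewrite adj_sym.
exists (fun i : 'I_2 => nth a [:: a; b] i); last first.
  by move=> [[|[|//]] ?] [[|[|//]] ?] /=; rewrite ?ab ?ba ?adj_irr.
by move=> [[|[|//]] ?] [[|[|//]] ?] /= e; try exact: val_inj; move: ab; rewrite e adj_irr.
Qed.

(** Assembles [P3_K2] and [three_K2] from pieces found in different components. The target is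
    [induced (S :|: T)] so that the lemma can be iterated. *)
Lemma disjoint_union_embeds (A B G : sgraph) (S T : {set G}) :
  embeds A (induced S) -> embeds B (induced T) ->
  {in S & T, forall x y, (x != y) && ~~ adj x y} ->
  embeds (disjoint_union A B) (induced (S :|: T)).
Proof.
move=> [f fI fE] [g gI gE] sep.
pose h (u : A + B) := match u with inl x => val (f x) | inr y => val (g y) end.
have hST u : h u \in S :|: T.
  by case: u => x; rewrite inE; apply/orP; [left|right]; apply: valP.
have sepfg x y : (val (f x) != val (g y)) && ~~ adj (val (f x)) (val (g y)).
  by apply: sep; apply: valP.
exists (fun u : disjoint_union A B => exist _ (h u) (hST u) : induced (S :|: T)).
  move=> [x|x] [y|y] [] /=.
  - by move/val_inj/fI->.
  - by move=> e; have /andP[/eqP/(_ e)] := sepfg x y.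
  - by move=> e; have /andP[/eqP/(_ (esym e))] := sepfg y x.
  - by move/val_inj/gI->.
move=> [x|x] [y|y] /=.
- exact: fE.
- by have /andP[_ /negbTE] := sepfg x y.
- by rewrite /induced_adj adj_sym; have /andP[_ /negbTE] := sepfg y x.
- exact: gE.
Qed.

(** * Clique, chromatic and pseudoachromatic numbers *)

Lemma clique_number_leq_chromatic (G : sgraph) : clique_number G <= chromatic_number G.
Proof.
rewrite /chromatic_number; case: ex_minnP => k /existsP[c /forallP cP] _.
apply/bigmax_leqP => S /forall_inP SP.
rewrite -[leqRHS]card_ord; apply: leq_trans (max_card [in c @: S]).
rewrite card_in_imset // => x y xS yS cxy; apply/eqP; apply: contraT => xy.
have /forall_inP/(_ y yS)/implyP/(_ xy) := SP x xS.
by move=> /(implyP (forallP (cP x) y)); rewrite cxy eqxx.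
Qed.

Lemma colorable_chromatic (G : sgraph) : colorable G (chromatic_number G).
Proof. by rewrite /chromatic_number; case: ex_minnP. Qed.

Lemma chromatic_leq (G : sgraph) k : colorable G k -> chromatic_number G <= k.
Proof. by rewrite /chromatic_number; case: ex_minnP => m _ mP /mP. Qed.

Lemma leq_pseudoachromatic (G : sgraph) k :
  k <= #|G| -> complete_colorable G k -> k <= pseudoachromatic_number G.
Proof.
rewrite -ltnS => kG kc.
exact: (@leq_bigmax_cond _ (fun i : 'I_#|G|.+1 => complete_colorable G i) val (Ordinal kG) kc).
Qed.

(* Two color classes of a proper coloring with no edge between them can be merged. *)
Lemma complete_colorable_chromatic (G : sgraph) : complete_colorable G (chromatic_number G).
Proof.
have /existsP[c cP] := colorable_chromatic G.
have cadj x y : adj x y -> c x != c y by have /forallP/(_ x)/forallP/(_ y)/implyP := cP.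
apply/existsP; exists c; apply/forallP => i; apply/forallP => j; apply/implyP => ij.
(* The inequality is absurd because the color [i] shows that the chromatic number is positive. *)
apply: contraT => noedge; suff: chromatic_number G <= (chromatic_number G).-1.
  by case: (chromatic_number G) i {c cP cadj j ij noedge} => [[] | n _] //=; rewrite ltnn.
have noE x y : adj x y -> c x = i -> c y = j -> False.
  move=> xy cx cy; case/negP: noedge.
  by apply/existsP; exists x; apply/existsP; exists y; rewrite xy cx cy !eqxx.
have [j0 jE _] := unlift_some ij.
(* [unlift i] removes [i] from the palette; vertices of color [i] receive [j0], which is [j] after
   the removal. *)
pose c' : {ffun G -> 'I_(chromatic_number G).-1} := [ffun x => odflt j0 (unlift i (c x))].
apply/chromatic_leq/existsP; exists c'.
apply/forallP => x; apply/forallP => y; apply/implyP => xy; rewrite !ffunE.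
have yx : adj y x by rewrite adj_sym.
have := cadj x y xy; have := noE x y xy; have := noE y x yx.
case: unliftP => [x' ->|->]; case: unliftP => [y' ->|->] /=.
- by move=> _ _; apply: contra_neq => ->.
- by move=> /(_ erefl) n1 _ _; apply/eqP => e; apply: n1; rewrite jE e.
- by move=> _ /(_ erefl) n1 _; apply/eqP => e; apply: n1; rewrite jE -e.
- by rewrite eqxx.
Qed.

Lemma chromatic_leq_pseudoachromatic (G : sgraph) :
  chromatic_number G <= pseudoachromatic_number G.
Proof.
apply: leq_pseudoachromatic (complete_colorable_chromatic G).
have [G0 | /complete_colorable_leq->//] := posnP #|G|; last exact: complete_colorable_chromatic.
rewrite G0; apply: chromatic_leq; apply/existsP.
have no (x : G) : 'I_0 by have := max_card (pred1 x); rewrite G0 card1.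
exists [ffun x => no x]; apply/forallP => x; by case: (no x).
Qed.

Lemma colorable2 (G : sgraph) (c : G -> bool) :
  (forall x y, adj x y -> c x != c y) -> colorable G 2.
Proof.
move=> cP; apply/existsP; exists [ffun x => inord (c x)].
apply/forallP => x; apply/forallP => y; apply/implyP => /cP.
rewrite !ffunE; apply: contra_neq => /(congr1 val) /=.
by rewrite !inordK ?ltnS ?leq_b1 //; case: (c x); case: (c y).
Qed.

Lemma complete_colorable3 (G : sgraph) (c : G -> nat) x1 y1 x2 y2 x3 y3 :
  [/\ adj x1 y1, c x1 = 0 & c y1 = 1] -> [/\ adj x2 y2, c x2 = 1 & c y2 = 2] ->
  [/\ adj x3 y3, c x3 = 2 & c y3 = 0] -> complete_colorable G 3.
Proof.
move=> [a1 cx1 cy1] [a2 cx2 cy2] [a3 cx3 cy3].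
apply/existsP; exists [ffun x => inord (c x)].
have P x y (i j : 'I_3) : adj x y -> c x = i -> c y = j ->
    [exists x, exists y, [&& adj x y, [ffun x => inord (c x)] x == i
      & [ffun x => inord (c x)] y == j]].
  move=> xy cx cy; apply/existsP; exists x; apply/existsP; exists y.
  by rewrite xy !ffunE cx cy !inord_val !eqxx.
have b1 : adj y1 x1 by rewrite adj_sym.
have b2 : adj y2 x2 by rewrite adj_sym.
have b3 : adj y3 x3 by rewrite adj_sym.
apply/forallP => -[[|[|[|//]]] ?]; apply/forallP => -[[|[|[|//]]] ?] //; apply/implyP => _.
- exact: P a1 _ _.
- exact: P b3 _ _.
- exact: P b1 _ _.
- exact: P a2 _ _.
- exact: P a3 _ _.
- exact: P b2 _ _.
Qed.

Lemma isomorphic_colorable (G H : sgraph) k :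
  isomorphic G H -> colorable H k -> colorable G k.
Proof.
move=> [f _ fE] /existsP[c /forallP cP]; apply/existsP; exists [ffun x => c (f x)].
apply/forallP => x; apply/forallP => y; rewrite !ffunE -fE; exact: (forallP (cP _)).
Qed.

Lemma isomorphic_complete_colorable (G H : sgraph) k :
  isomorphic G H -> complete_colorable H k -> complete_colorable G k.
Proof.
move=> [f [g fK gK] fE] /existsP[c /forallP cP]; apply/existsP; exists [ffun x => c (f x)].
apply/forallP => i; apply/forallP => j; apply/implyP.
move=> /(implyP (forallP (cP i) j))/existsP[x /existsP[y /and3P[xy cx cy]]].
by apply/existsP; exists (g x); apply/existsP; exists (g y); rewrite !ffunE -fE !gK xy cx.
Qed.

(** An induced copy of [H] would have chromatic number at most 2 and pseudoachromatic number at
    least 3. *)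
Lemma chi_psi_perfect_free (G H : sgraph) :
  perfect chromatic_number pseudoachromatic_number G ->
  colorable H 2 -> complete_colorable H 3 -> free H G.
Proof.
move=> Gp H2 H3 S iso; have := Gp S.
have le2 := chromatic_leq (isomorphic_colorable iso H2).
have cc3 := isomorphic_complete_colorable iso H3.
have S0 : 0 < #|induced S|.
  have /existsP[c /forallP/(_ ord0)/forallP/(_ ord_max)] := cc3.
  by move=> /existsP[x _]; apply/card_gt0P; exists x.
have := leq_pseudoachromatic (complete_colorable_leq S0 cc3) cc3.
by move=> le3 e; rewrite e leqNgt le3 in le2.
Qed.

Lemma chi_psi_perfect_forbidden_free (G : sgraph) :
  perfect chromatic_number pseudoachromatic_number G -> forbidden_free G.
Proof.
move=> Gp; split; apply: chi_psi_perfect_free => //.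
- apply: (@colorable2 C4 (fun i : 'I_4 => odd i)).
  by move=> [[|[|[|[|//]]]] ?] [[|[|[|[|//]]]] ?].
(* The colors in order are 0, 1, 2, 0, so three consecutive edges realize the three pairs; the same
   coloring serves for [P4]. *)
- by apply: (@complete_colorable3 C4 (fun i : 'I_4 => i %% 3)
    (@Ordinal 4 0 isT) (@Ordinal 4 1 isT) (@Ordinal 4 1 isT) (@Ordinal 4 2 isT)
    (@Ordinal 4 2 isT) (@Ordinal 4 3 isT)).
- apply: (@colorable2 P4 (fun i : 'I_4 => odd i)).
  by move=> [[|[|[|[|//]]]] ?] [[|[|[|[|//]]]] ?].
- by apply: (@complete_colorable3 P4 (fun i : 'I_4 => i %% 3)
    (@Ordinal 4 0 isT) (@Ordinal 4 1 isT) (@Ordinal 4 1 isT) (@Ordinal 4 2 isT)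
    (@Ordinal 4 2 isT) (@Ordinal 4 3 isT)).
- apply: (@colorable2 P3_K2 (fun u => match u with inl i => odd i | inr i => odd i end)).
  by move=> [[[|[|[|//]]] ?]|[[|[|//]] ?]] [[[|[|[|//]]] ?]|[[|[|//]] ?]].
(* The path is colored 0, 1, 2 and the separate edge 0, 2. *)
- by apply: (@complete_colorable3 P3_K2
    (fun u => match u with inl i => val i | inr i => (val i).*2 end)
    (inl (@Ordinal 3 0 isT)) (inl (@Ordinal 3 1 isT))
    (inl (@Ordinal 3 1 isT)) (inl (@Ordinal 3 2 isT))
    (inr (@Ordinal 2 1 isT)) (inr (@Ordinal 2 0 isT))).
- apply: (@colorable2 three_K2 (fun u => match u with
    inl i => odd i | inr (inl i) => odd i | inr (inr i) => odd i end)).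
  by move=> [[[|[|//]] ?]|[[[|[|//]] ?]|[[|[|//]] ?]]]
    [[[|[|//]] ?]|[[[|[|//]] ?]|[[|[|//]] ?]]].
(* The three edges are colored 0, 1 then 1, 2 then 0, 2. *)
- by apply: (@complete_colorable3 three_K2
    (fun u => match u with inl i => val i | inr (inl i) => (val i).+1
       | inr (inr i) => (val i).*2 end)
    (inl (@Ordinal 2 0 isT)) (inl (@Ordinal 2 1 isT))
    (inr (inl (@Ordinal 2 0 isT))) (inr (inl (@Ordinal 2 1 isT)))
    (inr (inr (@Ordinal 2 1 isT))) (inr (inr (@Ordinal 2 0 isT)))).
Qed.

(** * Components and universal vertices *)

Lemma connect_adj_sym (G : sgraph) : connect_sym (@adj G).
Proof. exact/sym_connect_sym/adj_sym. Qed.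

Lemma nontrivial_componentsP (G : sgraph) (C : {set G}) :
  reflect (exists x y, adj x y /\ C = [set z | connect (@adj G) x z])
          (C \in nontrivial_components G).
Proof.
rewrite inE; apply: (iffP andP) => [[/imsetP[x _ ->]] | [x [y [xy ->]]]].
  move=> /card_gt1P[u [v []]]; rewrite !inE /= => xu xv uv.
  suff [w xw] : exists w, adj x w.
    by exists x, w; split=> //; apply/setP => z; rewrite !inE.
  have [w xw wx] : exists2 w, connect (@adj G) x w & w != x.
    by have [ux|] := eqVneq u x; [exists v; rewrite // -ux eq_sym | exists u].
  (* The first edge of a path from [x] to another vertex of its class is the required edge at
     [x]. *)
  have /connectP[[|p ps] /= xp ew] := xw; first by rewrite ew eqxx in wx.
  by exists p; case/andP: xp.
split; first by apply/imsetP; exists x => //; apply/setP => z; rewrite !inE.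
apply/card_gt1P; exists x, y; rewrite !inE connect0 connect1 //; split=> //.
by apply: contraTneq xy => ->; rewrite adj_irr.
Qed.

Lemma nontrivial_component_connect (G : sgraph) (C : {set G}) x y :
  C \in nontrivial_components G -> x \in C -> (y \in C) = connect (@adj G) x y.
Proof.
move=> /nontrivial_componentsP[u [v [_ ->]]]; rewrite !inE => ux.
by rewrite (same_connect (@connect_adj_sym G) ux).
Qed.

Lemma nontrivial_component_adj (G : sgraph) (x y : G) :
  adj x y -> exists2 C, C \in nontrivial_components G & (x \in C) && (y \in C).
Proof.
move=> xy; exists [set z | connect (@adj G) x z]; last by rewrite !inE connect0 connect1.
by apply/nontrivial_componentsP; exists x, y.
Qed.

Lemma nontrivial_component_edge (G : sgraph) (C : {set G}) :
  C \in nontrivial_components G -> exists x y : induced C, adj x y.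
Proof.
move=> /nontrivial_componentsP[x [y [xy ->]]].
have xC : x \in [set z | connect (@adj G) x z] by rewrite inE.
have yC : y \in [set z | connect (@adj G) x z] by rewrite inE connect1.
by exists (exist _ x xC), (exist _ y yC).
Qed.

Lemma nontrivial_components_sep (G : sgraph) (C D : {set G}) :
  C \in nontrivial_components G -> D \in nontrivial_components G -> C != D ->
  {in C & D, forall x y, (x != y) && ~~ adj x y}.
Proof.
move=> CG DG CD x y xC yD; rewrite -negb_or; apply: contra CD => xy.
have xyc : connect (@adj G) x y.
  by case/orP: xy => [/eqP->|/connect1].
have yC : y \in C by rewrite (nontrivial_component_connect _ CG xC).
apply/eqP/setP => z.
by rewrite (nontrivial_component_connect z CG yC) (nontrivial_component_connect z DG yD).
Qed.

(** If no vertex were at distance two from [x], its closed neighborhood would be closed under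
    adjacency and would contain [y]. *)
Lemma connect_distance2 (G : sgraph) (x y : G) :
  connect (@adj G) x y -> x != y -> ~~ adj x y ->
  exists u w, [/\ adj x u, adj u w, x != w & ~~ adj x w].
Proof.
move=> cxy xy nxy; pose N := [pred z | (x == z) || adj x z].
have [/existsP[u /existsP[w /and4P[]]] | no] :=
  boolP [exists u, exists w, [&& adj x u, adj u w, x != w & ~~ adj x w]].
  by exists u, w.
have clN : closed (@adj G) N.
  apply: intro_closed => [|u w uw]; first exact: connect_adj_sym.
  rewrite !inE; case/orP => [/eqP->|xu]; first by rewrite uw orbT.
  apply: contraR no; rewrite negb_or => xw.
  by apply/existsP; exists u; apply/existsP; exists w; rewrite xu uw.
have := closed_connect clN cxy; rewrite !inE eqxx /=.
by rewrite (negbTE xy) (negbTE nxy).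
Qed.

Definition universal (G : sgraph) (v : G) : bool := [forall w, (v != w) ==> adj v w].

Lemma universalP (G : sgraph) (v : G) : reflect (forall w, v != w -> adj v w) (universal v).
Proof. by apply: (iffP forallP) => h w; apply/implyP/h. Qed.

Lemma connected_universal (G : sgraph) (v0 : G) :
  forbidden_free G -> connected G -> exists v : G, universal v.
Proof.
move=> [/freeP noC4 /freeP noP4 _ _] Gc.
pose N (v : G) := [set w | (v == w) || adj v w].
case: (@arg_maxnP _ v0 predT (fun v => #|N v|) isT) => v _ vmax.
exists v; apply/universalP => y vy; apply: contraT => nvy.
have [u [w [vu uw vw nvw]]] := connect_distance2 (Gc v y) vy nvy.
(* Otherwise [w], which lies in [N u] but not in [N v], would make [N u] larger than the maximum. *)
have /subsetPn[z zv zu] : ~~ (N v \subset N u).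
  apply/negP => sub; have := vmax u isT; rewrite /= leqNgt => /negP; apply.
  apply: proper_card; apply/properP; split=> //; exists w; rewrite !inE.
    by rewrite uw orbT.
  by rewrite negb_or vw.
move: zu zv; rewrite !inE negb_or => /andP[uz nuz] /orP[/eqP ez|vz].
  by case/negP: nuz; rewrite -ez adj_sym.
have zv : adj z v by rewrite adj_sym.
have nzu : ~~ adj z u by rewrite adj_sym.
(* All adjacencies among [z], [v], [u], [w] are known except [w z], which decides between a 4-cycle
   and a path. *)
case: noC4; have [wz|nwz] := boolP (adj w z).
  by apply: (@C4_embeds _ z v u w) => //; rewrite eq_sym.
by case: noP4; apply: (@P4_embeds _ z v u w).
Qed.

(** * The structure theorem *)

(** The proof counts non-trivial components: one edge from each of three gives [three_K2]; if there
    are two and one is not complete, an induced [P3] in it and an edge of the other give [P3_K2]. *)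
Lemma forbidden_free_disconnected (G : sgraph) : forbidden_free G -> disconnected_structure G.
Proof.
move=> Gf; have [_ _ /freeP noP3K2 /freeP no3K2] := Gf.
case: (ltngtP #|nontrivial_components G| 2) => [lt2 | gt2 | eq2].
- case: (posnP #|nontrivial_components G|) => [/cards0_eq N0 | gt0].
    constructor 1 => x y; apply/negP => /nontrivial_component_adj[C].
    by rewrite N0 inE.
  have /cards1P[C CE] : #|nontrivial_components G| == 1 by rewrite eqn_leq gt0 -ltnS lt2.
  by constructor 3; exists C => //; apply: forbidden_free_embeds (induced_embeds C) Gf.
- have [A [B [C [[AG BG CG] [AB BC CA]]]]] := card_gt2P gt2.
  case: no3K2; apply: embeds_trans (induced_embeds (A :|: (B :|: C))).
  have K2 D : D \in nontrivial_components G -> embeds (complete_graph 2) (induced D).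
    by move=> /nontrivial_component_edge[x [y /K2_embeds]].
  apply: disjoint_union_embeds; [exact: K2 | apply: disjoint_union_embeds; first exact: K2 | ].
  + exact: K2.
  + exact: nontrivial_components_sep.
  + move=> x y xA; rewrite inE => /orP[yB|yC].
      exact: nontrivial_components_sep xA yB.
    by apply: nontrivial_components_sep xA yC; rewrite // eq_sym.
- constructor 2; split=> // C CG [x xC] [y yC]; rewrite -val_eqE /= => xy.
  apply: contraT; rewrite /= /induced_adj /= => nxy.
  have cxy : connect (@adj G) x y by rewrite -(nontrivial_component_connect y CG xC).
  have [u [w [xu uw xw nxw]]] := connect_distance2 cxy xy nxy.
  have uC : u \in C by rewrite (nontrivial_component_connect u CG xC) connect1.
  have wC : w \in C by rewrite (nontrivial_component_connect w CG uC) connect1.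
  have [D DG DC] : exists2 D, D \in nontrivial_components G & D != C.
    have /card_gt1P[A [B [AG BG AB]]] : 1 < #|nontrivial_components G| by rewrite eq2.
    by have [eAC|] := eqVneq A C; [exists B; rewrite // -eAC eq_sym | exists A].
  case: noP3K2; apply: embeds_trans (induced_embeds (C :|: D)).
  apply: disjoint_union_embeds.
  + exact: (@P3_embeds (induced C) (exist _ x xC) (exist _ u uC) (exist _ w wC)).
  + by have [p [q /K2_embeds]] := nontrivial_component_edge DG.
  + by apply: nontrivial_components_sep; rewrite // eq_sym.
Qed.

Lemma forbidden_free_connected (G : sgraph) :
  forbidden_free G -> connected G -> connected_structure G.
Proof.
move=> Gf Gc; pose U := [set v : G | universal v].
have UE v w : v \in U -> v != w -> adj v w by rewrite inE => /universalP; apply.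
have [UT | /forallPn[v0 v0U]] := boolP [forall v, v \in U].
  by left=> x y; apply: UE; apply: (forallP UT).
(* The universal vertices form the complete factor. The rest is disconnected, since a universal
   vertex of it would be universal in [G] and hence belong to [U]. *)
right; exists #|U|, (induced (~: U)).
have ff : forbidden_free (induced (~: U)).
  exact: forbidden_free_embeds (induced_embeds _) Gf.
split; last exact: forbidden_free_disconnected.
- have [v vU] := connected_universal v0 Gf Gc.
  by apply/card_gt0P; exists v; rewrite inE.
- have CP x : x \notin U -> x \in ~: U by rewrite in_setC.
  pose f (x : G) : join (complete_graph #|U|) (induced (~: U)) :=
    match boolP (x \in U) with
    | AltTrue xU => inl (enum_rank_in xU x)
    | AltFalse xU => inr (exist _ x (CP x xU))
    end.
  pose g (u : 'I_#|U| + induced (~: U)) : G :=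
    match u with inl i => enum_val i | inr x => val x end.
  have fK : cancel f g.
    by move=> x; rewrite /f; case: {-}_ / boolP => xU /=; rewrite ?enum_rankK_in.
  have gI : injective g.
    move=> [i|[x /= xU]] [j|[y /= yU]] /=.
    - by move/enum_val_inj->.
    - by move=> e; exfalso; move: yU; rewrite -e in_setC enum_valP.
    - by move=> e; exfalso; move: xU; rewrite e in_setC enum_valP.
    - by move=> e; congr inr; apply: val_inj.
  have gK : cancel g f by move=> u; apply: gI; rewrite fK.
  exists f; first by exists g.
  (* Adjacency is compared along the inverse [g], whose arguments split into the two sides of the
     join. *)
  suff gE (u v : join (complete_graph #|U|) (induced (~: U))) : adj u v = adj (g u) (g v).
    by move=> x y; rewrite gE !fK.
  move: u v => [i|[x /= xU]] [j|[y /= yU]] //=.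
  - rewrite /complete_adj; have [->|ij] := eqVneq i j; first by rewrite adj_irr.
    by rewrite UE ?enum_valP //; apply: contra_neq ij => /enum_val_inj.
  - rewrite UE ?enum_valP //; apply: contraTneq yU => <-.
    by rewrite in_setC enum_valP.
  - rewrite adj_sym UE ?enum_valP //; apply: contraTneq xU => <-.
    by rewrite in_setC enum_valP.
- have v0C : v0 \in ~: U by rewrite in_setC.
  move=> /(connected_universal (exist _ v0 v0C : induced (~: U)) ff)[[v vU] /universalP vP].
  move: (vU); rewrite in_setC inE => /negP; apply; apply/universalP => w vw.
  have [wU|wU] := boolP (w \in U); first by rewrite adj_sym UE // eq_sym.
  have wC : w \in ~: U by rewrite in_setC.
  exact: (vP (exist _ w wC)).
Qed.

(** * The structured graphs are forbidden-free *)

(** Three obstructions to placing a copy of [H]: [no_isolated] keeps it out of trivial components,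
    [no_universal] out of the factor [K_m] of a join, and [has_P3] out of disjoint unions of
    complete graphs. *)
Definition no_isolated (H : sgraph) : Prop := forall x : H, exists y, adj x y.

Definition no_universal (H : sgraph) : Prop := forall x : H, exists2 y, x != y & ~~ adj x y.

Definition has_P3 (H : sgraph) : Prop :=
  exists x y z : H, [/\ adj x y, adj y z, x != z & ~~ adj x z].

Lemma C4_properties : [/\ no_isolated C4, no_universal C4 & has_P3 C4].
Proof.
split.
- move=> [[|[|[|[|//]]]] ?]; [exists (@Ordinal 4 1 isT) | exists (@Ordinal 4 0 isT)
    | exists (@Ordinal 4 1 isT) | exists (@Ordinal 4 0 isT)] => //.
- move=> [[|[|[|[|//]]]] ?]; [exists (@Ordinal 4 2 isT) | exists (@Ordinal 4 3 isT)
    | exists (@Ordinal 4 0 isT) | exists (@Ordinal 4 1 isT)] => //.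
- by exists (@Ordinal 4 0 isT), (@Ordinal 4 1 isT), (@Ordinal 4 2 isT).
Qed.

Lemma P4_properties : [/\ no_isolated P4, no_universal P4 & has_P3 P4].
Proof.
split.
- move=> [[|[|[|[|//]]]] ?]; [exists (@Ordinal 4 1 isT) | exists (@Ordinal 4 0 isT)
    | exists (@Ordinal 4 1 isT) | exists (@Ordinal 4 2 isT)] => //.
- move=> [[|[|[|[|//]]]] ?]; [exists (@Ordinal 4 2 isT) | exists (@Ordinal 4 3 isT)
    | exists (@Ordinal 4 0 isT) | exists (@Ordinal 4 1 isT)] => //.
- by exists (@Ordinal 4 0 isT), (@Ordinal 4 1 isT), (@Ordinal 4 2 isT).
Qed.

Lemma P3_K2_properties : [/\ no_isolated P3_K2, no_universal P3_K2 & has_P3 P3_K2].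
Proof.
split.
- move=> [[[|[|[|//]]] ?]|[[|[|//]] ?]]; [exists (inl (@Ordinal 3 1 isT))
    | exists (inl (@Ordinal 3 0 isT)) | exists (inl (@Ordinal 3 1 isT))
    | exists (inr (@Ordinal 2 1 isT)) | exists (inr (@Ordinal 2 0 isT))] => //.
- by move=> [x|x]; [exists (inr ord0) | exists (inl ord0)].
- by exists (inl (@Ordinal 3 0 isT)), (inl (@Ordinal 3 1 isT)), (inl (@Ordinal 3 2 isT)).
Qed.

Lemma K2_no_isolated : no_isolated (complete_graph 2).
Proof. by move=> [[|[|//]] ?]; [exists (@Ordinal 2 1 isT) | exists (@Ordinal 2 0 isT)]. Qed.

Lemma three_K2_properties : no_isolated three_K2 /\ no_universal three_K2.
Proof.
split; last by move=> [x|x]; [exists (inr (inl ord0)) | exists (inl ord0)].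
move=> [x|[x|x]]; have [y xy] := K2_no_isolated x.
- by exists (inl y).
- by exists (inr (inl y)).
- by exists (inr (inr y)).
Qed.

Lemma embeds_one_component (H G : sgraph) (C : {set G}) :
  no_isolated H -> nontrivial_components G = [set C] -> embeds H G -> embeds H (induced C).
Proof.
move=> isoH GC [f fI fE].
have fC x : f x \in C.
  have [y xy] := isoH x; rewrite -fE in xy.
  by have [D] := nontrivial_component_adj xy; rewrite GC => /set1P-> /andP[].
exists (fun x => exist _ (f x) (fC x) : induced C) => // x y [] /fI.
exact: id.
Qed.

Lemma is_complete_induced (G : sgraph) (S : {set G}) :
  is_complete (induced S) -> {in S &, forall x y, x != y -> adj x y}.
Proof. by move=> Sc x y xS yS; apply: (Sc (exist _ x xS) (exist _ y yS)). Qed.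

(** The three vertices of a [P3] lie in one component, whose completeness joins the two ends. *)
Lemma complete_components_no_P3 (G : sgraph) :
  (forall C, C \in nontrivial_components G -> is_complete (induced C)) -> ~ has_P3 G.
Proof.
move=> Gc [x [y [z [xy yz xz /negP[]]]]].
have [C CG /andP[xC yC]] := nontrivial_component_adj xy.
have zC : z \in C by rewrite (nontrivial_component_connect z CG yC) connect1.
exact: is_complete_induced (Gc C CG) x z xC zC xz.
Qed.

Lemma embeds_has_P3 (H G : sgraph) : embeds H G -> has_P3 H -> has_P3 G.
Proof.
move=> [f fI fE] [x [y [z [xy yz xz nxz]]]]; exists (f x), (f y), (f z).
by rewrite !fE (inj_eq fI).
Qed.

(** Vertices from different edges of the copy are non-adjacent, so they lie in different complete
    components, which requires three of them. *)
Lemma complete_components_no_three_K2 (G : sgraph) :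
  #|nontrivial_components G| = 2 ->
  (forall C, C \in nontrivial_components G -> is_complete (induced C)) -> ~ embeds three_K2 G.
Proof.
move=> G2 Gc [f fI fE].
have Nf u : exists2 C, C \in nontrivial_components G & f u \in C.
  have [v uv] := three_K2_properties.1 u; rewrite -fE in uv.
  by have [C CG /andP[uC _]] := nontrivial_component_adj uv; exists C.
have adjC C u v : C \in nontrivial_components G -> f u \in C -> f v \in C -> u != v -> adj u v.
  move=> CG uC vC uv; rewrite -fE.
  by apply: is_complete_induced (Gc C CG) _ _ uC vC _; rewrite (inj_eq fI).
have [A AG aA] := Nf (inl ord0).
have [B BG bB] := Nf (inr (inl ord0)).
have [C CG cC] := Nf (inr (inr ord0)).
have AB : A != B by apply/eqP => e; rewrite -e in bB; have := adjC A _ _ AG aA bB isT.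
have BC : B != C by apply/eqP => e; rewrite -e in cC; have := adjC B _ _ BG bB cC isT.
have CA : C != A by apply/eqP => e; rewrite e in cC; have := adjC A _ _ AG aA cC isT.
suff: 2 < #|nontrivial_components G| by rewrite G2.
by apply/card_gt2P; exists A, B, C.
Qed.

Lemma disconnected_structure_free (G : sgraph) : disconnected_structure G -> forbidden_free G.
Proof.
have [iC4 _ pC4] := C4_properties; have [iP4 _ pP4] := P4_properties.
have [iP3 _ pP3] := P3_K2_properties; have [i3 _] := three_K2_properties.
case=> [G0 | [G2 Gc] | [C GC [/freeP fC4 /freeP fP4 /freeP fP3 /freeP f3]]].
- have edge (H : sgraph) : H -> no_isolated H -> free H G.
    move=> x isoH; apply/freeP => -[f _ fE]; have [y xy] := isoH x.
    by have := G0 (f x) (f y); rewrite fE xy.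
  split; apply: edge => //; [exact: ord0 | exact: ord0 | exact: (inl ord0) | exact: (inl ord0)].
- have noP3 := complete_components_no_P3 Gc.
  split; apply/freeP; last exact: complete_components_no_three_K2.
  + by move=> e; apply: noP3; apply: embeds_has_P3 e pC4.
  + by move=> e; apply: noP3; apply: embeds_has_P3 e pP4.
  + by move=> e; apply: noP3; apply: embeds_has_P3 e pP3.
- by split; apply/freeP => /(embeds_one_component _ GC) e;
    [apply: fC4 | apply: fP4 | apply: fP3 | apply: f3]; apply: e.
Qed.

(** A vertex of [H] sent into the complete factor would be adjacent to all others, against
    [no_universal]. *)
Lemma embeds_join_complete (H G : sgraph) m :
  H -> no_universal H -> embeds H (join (complete_graph m) G) -> embeds H G.
Proof.
move=> h0 uH [f fI fE].
have fr x : exists y, f x = inr y.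
  case fx : (f x) => [i|y]; last by exists y.
  have [z xz] := uH x; rewrite -fE fx; case fz : (f z) => [j|//].
  rewrite /= /complete_adj negbK => /eqP ij.
  by move: xz; rewrite -(inj_eq fI) fx fz ij eqxx.
have [y0 _] := fr h0.
(* The default [y0] is never taken; [h0] only provides a vertex of [G] for it. *)
pose g x := match f x with inr y => y | inl _ => y0 end.
have gE x : f x = inr (g x) by rewrite /g; have [y ->] := fr x.
exists g => [x y e | x y]; first by apply: fI; rewrite !gE e.
by rewrite -fE !gE.
Qed.

Lemma complete_free (H G : sgraph) : H -> no_universal H -> is_complete G -> free H G.
Proof.
move=> x uH Gc; apply/freeP => -[f fI fE]; have [y xy /negP] := uH x; apply.
by rewrite -fE; apply: Gc; rewrite (inj_eq fI).
Qed.

Lemma connected_structure_free (G : sgraph) : connected_structure G -> forbidden_free G.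
Proof.
have [_ uC4 _] := C4_properties; have [_ uP4 _] := P4_properties.
have [_ uP3 _] := P3_K2_properties; have [_ u3] := three_K2_properties.
pose c4 : C4 := ord0; pose p4 : P4 := ord0.
pose p3 : P3_K2 := inl ord0; pose k3 : three_K2 := inl ord0.
case=> [Gc | [m [G' [_ /isomorphic_embeds iso _]]]].
  by split; [exact: complete_free c4 _ Gc | exact: complete_free p4 _ Gc
    | exact: complete_free p3 _ Gc | exact: complete_free k3 _ Gc].
move=> /disconnected_structure_free[/freeP fC4 /freeP fP4 /freeP fP3 /freeP f3].
split; apply/freeP => /embeds_trans/(_ iso) e.
- exact/fC4/(embeds_join_complete c4 uC4 e).
- exact/fP4/(embeds_join_complete p4 uP4 e).
- exact/fP3/(embeds_join_complete p3 uP3 e).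
- exact/f3/(embeds_join_complete k3 u3 e).
Qed.

(** * Cliques from complete colorings *)

Lemma cliqueP (G : sgraph) (S : {set G}) :
  reflect {in S &, forall x y, x != y -> adj x y} (clique S).
Proof.
apply: (iffP forall_inP) => [h x y xS yS | h x xS].
  by move: y yS; have /forall_inP h' := h x xS => y /h'/implyP.
by apply/forall_inP => y yS; apply/implyP; apply: h.
Qed.

Lemma clique_induced (G : sgraph) (S : {set G}) (K : {set induced S}) :
  clique K -> clique (val @: K).
Proof.
move=> /cliqueP KP; apply/cliqueP => _ _ /imsetP[x xK ->] /imsetP[y yK ->].
by rewrite val_eqE; apply: KP.
Qed.

Lemma card_induced (G : sgraph) (S : {set G}) : #|induced S| = #|S|.
Proof. by rewrite /induced /= card_sig; apply: eq_card. Qed.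

(* Completeness for a set [D] of colors only; the requirement that every color is
   used is not implied when [D] is a singleton. *)
Definition complete_on (G : sgraph) (K : finType) (c : G -> K) (D : {set K}) : Prop :=
  {in D, forall i, exists x, c x = i} /\
  {in D &, forall i j, i != j -> exists x y, [/\ adj x y, c x = i & c y = j]}.

(** Induction on the number of vertices. Measuring completeness on a subset [D] of the palette lets
    the induction drop a color without renumbering the others. *)
Lemma complete_on_clique (K : finType) (G : sgraph) (c : G -> K) (D : {set K}) :
  forbidden_free G -> complete_on c D -> exists2 Q : {set G}, clique Q & #|D| <= #|Q|.
Proof.
have [n] := ubnP #|G|; elim: n G c D => // n IHn G c D ltGn Gf [used pairs].
have [D0 | [i0 i0D]] := set_0Vmem D.
  by exists set0; [apply/cliqueP => x; rewrite inE | rewrite D0 cards0].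
have [x0 cx0] := used i0 i0D.
have [/existsP[v /universalP vU] | noU] := boolP [exists v : G, universal v].
  have vC x : x != v -> x \in [set~ v] by rewrite !inE.
  have [] := @IHn (induced [set~ v]) (c \o val) (D :\ c v).
  - rewrite card_induced -ltnS (leq_trans _ ltGn) // ltnS cardsC1.
    by rewrite prednK //; apply/card_gt0P; exists v.
  - exact: forbidden_free_embeds (induced_embeds _) Gf.
  - split=> [i | i j]; rewrite !inE => /andP[iv iD].
      have [x cx] := used i iD.
      (* Only colors other than [c v] remain, so every witness survives the deletion of [v]. *)
      have xv : x != v by apply: contra_neq iv => <-.
      by exists (exist _ x (vC x xv)).
    move=> /andP[jv jD] ij; have [x [y [xy cx cy]]] := pairs i j iD jD ij.
    have xv : x != v by apply: contra_neq iv => <-.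
    have yv : y != v by apply: contra_neq jv => <-.
    by exists (exist _ x (vC x xv)), (exist _ y (vC y yv)).
  move=> Q Qc DQ; exists (v |: val @: Q); last first.
    rewrite cardsU1 card_imset; last exact: val_inj.
    have -> : v \notin val @: Q.
      by apply/imsetP => -[[x xv] _ /= e]; move: xv; rewrite -e !inE eqxx.
    (* Removing [c v] costs at most one color, or none if [c v] is outside [D], while the clique
       gains [v]. *)
    by rewrite (cardsD1 (c v)) leq_add ?leq_b1.
  have /cliqueP QP := clique_induced Qc; apply/cliqueP => x y.
  rewrite !inE => /orP[/eqP->|xQ] /orP[/eqP->|yQ]; first by rewrite eqxx.
  - exact: vU.
  - by rewrite eq_sym adj_sym; apply: vU.
  - exact: QP.
have disc : ~ connected G.
  by move=> /(connected_universal x0 Gf)[v vU]; case/existsP: noU; exists v.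
have [D1 | D2] := leqP #|D| 1.
  exists [set x0]; last by rewrite cards1.
  by apply/cliqueP => x y /set1P-> /set1P->; rewrite eqxx.
have other i : i \in D -> exists2 j, j \in D & i != j.
  move=> iD; have /card_gt1P[a [b [aD bD ab]]] := D2.
  by have [ia|] := eqVneq i a; [exists b; rewrite // ia | exists a].
case: (forbidden_free_disconnected Gf) => [G0 | [G2 Gc] | [C GC Cf]].
- have [j jD ij] := other i0 i0D; have [x [y [xy _ _]]] := pairs i0 j i0D jD ij.
  by case/negP: (G0 x y).
- have /eqP/cards2P[A [B [AB GE]]] := G2.
  have AG : A \in nontrivial_components G by rewrite GE !inE eqxx.
  have BG : B \in nontrivial_components G by rewrite GE !inE eqxx orbT.
  have clC C : C \in nontrivial_components G -> clique C.
    by move=> CG; apply/cliqueP; apply: is_complete_induced (Gc C CG).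
  (* If a color [i] is missing in [A], every edge with an end of color [i] lies in [B], and these
     edges reach all the other colors. *)
  have [sA | /subsetPn[i iD iA]] := boolP (D \subset c @: A).
    by exists A; [exact: clC | exact: leq_trans (subset_leq_card sA) (leq_imset_card _ _)].
  exists B; first exact: clC.
  apply: leq_trans (leq_imset_card c B); apply/subset_leq_card/subsetP.
  have inB x y : adj x y -> c x = i -> (x \in B) && (y \in B).
    move=> /nontrivial_component_adj[C]; rewrite GE => /set2P[]-> // /andP[xA _] cx.
    by case/negP: iA; rewrite -cx imset_f.
  move=> j jD; have [ji|ji] := eqVneq j i.
    have [l lD il] := other i iD; have [x [y [xy cx cy]]] := pairs i l iD lD il.
    by have /andP[xB _] := inB x y xy cx; rewrite ji -cx imset_f.
  rewrite eq_sym in ji; have [x [y [xy cx cy]]] := pairs i j iD jD ji.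
  by have /andP[_ yB] := inB x y xy cx; rewrite -cy imset_f.
- have inC x y : adj x y -> (x \in C) && (y \in C).
    by move=> /nontrivial_component_adj[E]; rewrite GC => /set1P->.
  have CG : C \in nontrivial_components G by rewrite GC set11.
  have pairsC : {in D &, forall i j, i != j ->
      exists x y : induced C, [/\ adj x y, c (val x) = i & c (val y) = j]}.
    move=> i j iD jD ij; have [x [y [xy cx cy]]] := pairs i j iD jD ij.
    by have /andP[xC yC] := inC x y xy; exists (exist _ x xC), (exist _ y yC).
  (* Every edge lies in [C], and with at least two colors each color of [D] appears on an edge, so
     [c] restricted to [C] is still complete on [D]. Since [G] is disconnected, [C] is smaller than
     [G]. *)
  have [] := @IHn (induced C) (c \o val) D => //.
  + rewrite card_induced -ltnS (leq_trans _ ltGn) // ltnS -cardsT proper_card // properT.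
    apply/eqP => CT; apply: disc => x y.
    by rewrite -(nontrivial_component_connect y CG) CT inE.
  + split=> // i iD; have [j jD ij] := other i iD.
    by have [x [y [_ cx _]]] := pairsC i j iD jD ij; exists x.
  move=> Q Qc DQ; exists (val @: Q); first exact: clique_induced.
  by rewrite card_imset //; exact: val_inj.
Qed.

Lemma pseudoachromatic_leq_clique_number (G : sgraph) :
  forbidden_free G -> pseudoachromatic_number G <= clique_number G.
Proof.
move=> Gf; apply/bigmax_leqP => -[k /= kG] /existsP[c /forallP cP].
have [|Q Qc] := @complete_on_clique _ G c [set: 'I_k] Gf; last first.
  by rewrite cardsT card_ord => /leq_trans; apply; apply: leq_bigmax_cond.
have pairs i j : i != j -> exists x y, [/\ adj x y, c x = i & c y = j].
  move=> ij; have /existsP[x /existsP[y /and3P[xy /eqP cx /eqP cy]]] := implyP (forallP (cP i) j) ij.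
  by exists x, y.
split=> [i _ | i j _ _]; last exact: pairs.
(* With a single color there are no pairs, and a vertex using it comes from the bound [k <= #|G|];
   with more colors, an edge to a second color shows that [i] is used. *)
case: k kG c cP pairs i => [|[|k]] kG c cP pairs i; first by case: i.
  by have /card_gt0P[x _] := kG; exists x; rewrite !ord1.
have [j ij] : exists j : 'I_k.+2, i != j.
  by case: (eqVneq i ord0) => [->|]; [exists ord_max | exists ord0].
by have [x [_ [_ cx _]]] := pairs i j ij; exists x.
Qed.

Theorem theorem3 (G : sgraph) :
  [<-> perfect clique_number pseudoachromatic_number G;
       perfect chromatic_number pseudoachromatic_number G;
       forbidden_free G;
       (~ connected G -> disconnected_structure G) /\
       (connected G -> connected_structure G)].
Proof.
have le_omega_psi H : clique_number H <= pseudoachromatic_number H.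
  exact: leq_trans (clique_number_leq_chromatic H) (chromatic_leq_pseudoachromatic H).
tfae=> [Gp S | | Gf | [Gd Gc] S].
- apply/eqP; rewrite eqn_leq chromatic_leq_pseudoachromatic -Gp.
  exact: clique_number_leq_chromatic.
- exact: chi_psi_perfect_forbidden_free.
- by split=> [_ | ]; [exact: forbidden_free_disconnected | exact: forbidden_free_connected].
- have Gf : forbidden_free G.
    (* The boolean form of connectedness allows the case split without excluded middle. *)
    have [/'forall_forallP conn | disc] := boolP [forall x : G, forall y, connect (@adj G) x y].
      exact/connected_structure_free/Gc.
    apply/disconnected_structure_free/Gd => conn; case/negP: disc.
    by apply/'forall_forallP.
  apply/eqP; rewrite eqn_leq le_omega_psi pseudoachromatic_leq_clique_number //.
  exact: forbidden_free_embeds (induced_embeds S) Gf.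
Qed.
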